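(* Let $\Gamma$ be a game graph with vertex set $V(\Gamma)$ and edge set $E(\Gamma)$, and let $\mathcal{B}\subseteq V(\Gamma)$ be an independent set in $\Gamma$. Define $$\bar{\mathcal{P}}(\mathcal{B}) = \mathcal{B}\cup\bigcup_{B\in\mathcal{B}} N^-_\Gamma(B),$$ and $$\Phi(\Gamma,\mathcal{B}) = \{\mathcal{Q}\subseteq V(\Gamma) : \mathcal{P}(\Gamma[\mathcal{Q}])=\mathcal{B}\}.$$ Then $$\Phi(\Gamma,\mathcal{B}) = \{\mathcal{Q} : \mathcal{B}\subseteq \mathcal{Q}\subseteq \bar{\mathcal{P}}(\mathcal{B})\}.$$ In particular, $\mathcal{P}(\Gamma[\bar{\mathcal{P}}(\mathcal{B})])=\mathcal{B}$, and $\bar{\mathcal{P}}(\mathcal{B})$ is the maximum element of $\Phi(\Gamma,\mathcal{B})$ with respect to inclusion.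
   Context: A game graph (game) is a digraph $\Gamma=(V(\Gamma),E(\Gamma))$ such that for every vertex $P$ the maximum length $\mathrm{lg}_\Gamma(P)$ of a walk starting at $P$ is finite. If $(P,Q)\in E(\Gamma)$, then $Q$ is an option of $P$. The outcome of a position is defined recursively: $o_\Gamma(P)=\mathsf{N}$ if $P$ has an option $Q$ with $o_\Gamma(Q)=\mathsf{P}$, and $o_\Gamma(P)=\mathsf{P}$ otherwise. The $\mathsf{P}$-position set is $\mathcal{P}(\Gamma)=\{P\in V(\Gamma): o_\Gamma(P)=\mathsf{P}\}$. A set $\mathcal{B}\subseteq V(\Gamma)$ is independent if $(B,C)\notin E(\Gamma)$ for all $B,C\in\mathcal{B}$. The in-neighbor set of $P$ is $N^-_\Gamma(P)=\{R\in V(\Gamma):(R,P)\in E(\Gamma)\}$. For $\mathcal{Q}\subseteq V(\Gamma)$, $\Gamma[\mathcal{Q}]$ denotes the subgraph induced by $\mathcal{Q}$. *)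

(* Defs.v *)
From mathcomp Require Import all_boot.
From mathcomp Require Import boolp classical_sets.

Set Implicit Arguments.
Unset Strict Implicit.
Unset Printing Implicit Defensive.

Local Open Scope classical_set_scope.

(* The vertex set is a subset of an ambient type, so that the vertex set of an
   induced subgraph is a set of vertices of the original graph. *)
Record digraph (T : Type) := Digraph {
  vertices : set T;
  edges : set (T * T);
  edges_sub : edges `<=` vertices `*` vertices
}.

Section Walks.
Context {T : Type}.
Implicit Types (G : digraph T) (x : T).

(* The walk x, s_0, s_1, ..., whose length (number of edges) is [size s]. *)
Fixpoint walk G x (s : seq T) {struct s} : Prop :=
  match s with
  | [::] => vertices G x
  | y :: s' => edges G (x, y) /\ walk G y s'
  end.

(* [is_lg G x n]: n is the maximum length of a walk starting at x. *)
Definition is_lg G x (n : nat) : Prop :=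
  (exists s, walk G x s /\ size s = n) /\
  (forall s, walk G x s -> size s <= n).

End Walks.

Record game (T : Type) := Game {
  game_digraph :> digraph T;
  game_lg : forall x, vertices game_digraph x -> exists n, is_lg game_digraph x n
}.

Inductive outcome_class := N_outcome | P_outcome.

Section Games.
Context {T : Type}.
Implicit Types (G : game T) (B Q : set T).

Definition option_of G (q p : T) : Prop := edges G (p, q).

Lemma option_of_wf G : well_founded (option_of G).
Proof.
have accV n x : (forall s, walk G x s -> size s <= n) -> Acc (option_of G) x.
  elim: n x => [|n IHn] x bnd; constructor => y xy.
    have [_ Vy] := edges_sub xy.
    by have := bnd [:: y] (conj xy Vy).
  by apply: IHn => s ws; have := bnd (y :: s) (conj xy ws).
move=> x; constructor => y xy.
have [_ Vy] := edges_sub xy.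
have [n [_ bnd]] := game_lg Vy.
exact: accV bnd.
Qed.

Definition outcome G : T -> outcome_class :=
  Fix (option_of_wf G) (fun=> outcome_class)
    (fun p o => if `[< exists q (qp : option_of G q p), o q qp = P_outcome >]
                then N_outcome else P_outcome).

Lemma outcomeE G p :
  outcome G p =
    if `[< exists q, option_of G q p /\ outcome G q = P_outcome >]
    then N_outcome else P_outcome.
Proof.
rewrite {1}/outcome Fix_eq -/(outcome G); last first.
  move=> x f g fg; congr (if `[< _ >] then _ else _).
  by apply/propext; split=> -[q [qx h]]; exists q, qx; rewrite -h fg.
congr (if `[< _ >] then _ else _).
by apply/propext; split=> [[q [qp h]]|[q [qp h]]]; exists q; [split|exists qp].
Qed.

Definition P_positions G : set T :=
  [set p | vertices G p /\ outcome G p = P_outcome].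

Definition independent G B : Prop :=
  forall b c, B b -> B c -> ~ edges G (b, c).

Definition in_neighbors G (p : T) : set T := [set r | edges G (r, p)].

Lemma induced_edges_sub G Q :
  edges G `&` (Q `*` Q) `<=` (vertices G `&` Q) `*` (vertices G `&` Q).
Proof. by move=> [x y] [/edges_sub[Vx Vy] [Qx Qy]]. Qed.

(* For Q a set of vertices of G, the vertex set below is Q itself. *)
Definition induced_digraph G Q : digraph T :=
  Digraph (@induced_edges_sub G Q).

Lemma induced_lg G Q x : vertices (induced_digraph G Q) x ->
  exists n, is_lg (induced_digraph G Q) x n.
Proof.
move=> Vx; have [Vx' _] := Vx.
have sub s y : walk (induced_digraph G Q) y s -> walk G y s.
  by elim: s y => [|z s IHs] y /= [] // [yz _] /IHs.
have [m [_ bnd]] := game_lg Vx'.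
pose len k := `[< exists s, walk (induced_digraph G Q) x s /\ size s = k >].
have len0 : exists k, len k by exists 0; apply/asboolP; exists [::].
have lenm k : len k -> k <= m by move=> /asboolP[s [/sub/bnd ws <-]].
have [n /asboolP nP nmax] := ex_maxnP len0 lenm.
by exists n; split=> // s ws; apply: nmax; apply/asboolP; exists s.
Qed.

Definition induced G Q : game T := Game (@induced_lg G Q).

Definition Pbar G B : set T := B `|` \bigcup_(b in B) in_neighbors G b.

Definition Phi G B : set (set T) :=
  [set Q | Q `<=` vertices G /\ P_positions (induced G Q) = B].

End Games.

(* Main.v *)
Require Import Defs.
From mathcomp Require Import all_boot.
From mathcomp Require Import boolp classical_sets.

Local Open Scope classical_set_scope.

(** The P-positions of a game form its unique kernel: the only independent set
    of vertices such that every other vertex has an option in it. An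
    independent set [B] is thus the P-position set of the subgraph induced by
    [Q] iff [Q] contains [B] and consists, outside [B], of in-neighbors of
    [B]. *)

Lemma outcome_PE (T : Type) (G : game T) (p : T) :
  outcome G p = P_outcome <->
  forall q, edges G (p, q) -> outcome G q <> P_outcome.
Proof.
rewrite outcomeE; case: asboolP => [[q [pq oq]]|noP]; split=> //.
  by move=> /(_ q pq).
by move=> _ q pq oq; apply: noP; exists q.
Qed.

Lemma P_positions_absorbing (T : Type) (G : game T) (p : T) :
  vertices G p -> ~ P_positions G p ->
  exists2 q, P_positions G q & edges G (p, q).
Proof.
move=> Vp nPp; have : outcome G p <> P_outcome by move=> op; apply: nPp.
rewrite outcomeE; case: asboolP => // -[q [pq oq]] _.
by exists q => //; have [_ Vq] := edges_sub pq.
Qed.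

(** Well-founded induction along options: being a P-position and lying in [B] obey the same
    recursion, as each holds at a vertex exactly when it fails at all options of that vertex. *)
Lemma P_positions_kernel (T : Type) (G : game T) (B : set T) :
  B `<=` vertices G -> independent G B ->
  (forall p, vertices G p -> ~ B p -> exists2 b, B b & edges G (p, b)) ->
  P_positions G = B.
Proof.
move=> BV indB absB.
have oB p : vertices G p -> (outcome G p = P_outcome <-> B p).
  elim/(well_founded_ind (option_of_wf G)): p => p IHp Vp; split=> [op|Bp].
    apply: contrapT => /(absB p Vp)[b Bb pb].
    by move/outcome_PE: op => /(_ b pb); apply; apply/(IHp b pb)/Bb/BV.
  apply/outcome_PE => q pq; have [_ Vq] := edges_sub pq.
  by move/(IHp q pq Vq) => Bq; apply: (indB p q).
apply/seteqP; split=> [p [Vp /(oB p Vp)]//|p Bp].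
by split; [exact: BV|apply/oB => //; exact: BV].
Qed.

Lemma Pbar_sub_vertices (T : Type) (G : game T) (B : set T) :
  B `<=` vertices G -> Pbar G B `<=` vertices G.
Proof. by move=> BV p [/BV//|[b _ /edges_sub[]]]. Qed.

Theorem theorem3p1 (T : Type) (G : game T) (B : set T)
    (BV : B `<=` vertices G) (indB : independent G B) :
  Phi G B = [set Q | B `<=` Q /\ Q `<=` Pbar G B] /\
  P_positions (induced G (Pbar G B)) = B /\
  (Phi G B (Pbar G B) /\ forall Q, Phi G B Q -> Q `<=` Pbar G B).
Proof.
have PhiE : Phi G B = [set Q | B `<=` Q /\ Q `<=` Pbar G B].
  apply/seteqP; split=> Q /= => [[QV PB]|[BQ QP]].
    split=> [b|p Qp]; first by rewrite -PB => -[[]].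
    have [Bp|nBp] := EM (B p); first by left.
    (* Outside [B], [p] is not a P-position of the induced game, so it has an option in [B] there,
       hence also in [G]. *)
    have [||b] := P_positions_absorbing _ (induced G Q) p.
    - by split=> //; exact: QV.
    - by rewrite PB.
    - by rewrite PB => Bb [pb _]; right; exists b.
  split; first by move=> p /QP/(Pbar_sub_vertices _ _ _ BV).
  apply: P_positions_kernel => [b Bb|b c Bb Bc [bc _]|p [_ Qp] nBp].
  - by split; [exact: BV|exact: BQ].
  - exact: (indB b c).
  (* The edge from [p] to [b] survives in the induced subgraph because [B] lies in [Q]. *)
  - have [//|[b Bb pb]] := QP p Qp.
    by exists b => //; do 2!split => //; exact: BQ.
have PhiP : Phi G B (Pbar G B) by rewrite PhiE; split=> // b; left.
split=> //; split; first by case: PhiP.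
by split=> // Q; rewrite PhiE => -[].
Qed.
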